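(* Let $K$ be a field and let $(\mu(k))_{k\ge 0}$ be a sequence of elements of $K$ with $\mu(0)=1$ such that none of the Hankel determinants $H_k=\det(\mu(i+j))_{i,j=0}^{k-1}$, $k\ge 0$, vanishes. Let $p(k,j)$ be the signed coefficients of the associated monic orthogonal polynomials $p_k(x)=\sum_{j=0}^k(-1)^{k-j}p(k,j)x^j$, with $p(k,j)=0$ for $j>k$. Then for all integers $m\ge 0$ and $n\ge 1$, \[ \det(\mu(i+j))_{i,j=0}^{m-1}\cdot \det(p(i+m,j))_{i,j=0}^{n-1}=\det(\mu(i+j+n))_{i,j=0}^{m-1}. \]
   Context: The determinant of an empty ($0\times 0$) matrix is $1$; in particular $H_0=1$. For a sequence $(\mu(k))_{k\ge0}$ with all $H_k\neq 0$, and for each $k\ge 0$, the polynomial $p_k(x)$ and the coefficients $p(k,j)$, $0\le j\le k$, are defined by \[ p_k(x)=\sum_{j=0}^k(-1)^{k-j}p(k,j)\,x^j=\frac{1}{H_k}\det\begin{pmatrix} \mu(0) & \mu(1) & \cdots & \mu(k) \\ \mu(1) & \mu(2) & \cdots & \mu(k+1) \\ \vdots & \vdots & \ddots & \vdots \\ \mu(k-1) & \mu(k) & \cdots & \mu(2k-1) \\ 1 & x & \cdots & x^k \end{pmatrix}, \] a $(k+1)\times(k+1)$ determinant (so $p_0(x)=1$). Set $p(k,j)=0$ for $j>k$. These polynomials are orthogonal with respect to the linear functional sending $x^k$ to $\mu(k)$. *)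

(* Defs.v *)
From HB Require Import structures.
From mathcomp Require Import all_boot all_order all_algebra.

Set Implicit Arguments.
Unset Strict Implicit.
Unset Printing Implicit Defensive.

Import GRing.Theory.
Local Open Scope ring_scope.

Definition hankel_det (K : fieldType) (mu : nat -> K) (k : nat) : K :=
  \det (\matrix_(i < k, j < k) mu (i + j)%N).

Definition orthopoly_mx (K : fieldType) (mu : nat -> K) (k : nat) :
    'M[{poly K}]_k.+1 :=
  \matrix_(i < k.+1, j < k.+1)
    (if (i < k)%N then (mu (i + j)%N)%:P else 'X^j).

Definition orthopoly (K : fieldType) (mu : nat -> K) (k : nat) : {poly K} :=
  (hankel_det mu k)^-1 *: \det (orthopoly_mx mu k).

(* The sign is its own inverse, so this solves
   p_k(x) = \sum_(j <= k) (-1)^(k-j) p(k,j) x^j for p(k,j);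
   see orthopolyE below. *)
Definition orthocoef (K : fieldType) (mu : nat -> K) (k j : nat) : K :=
  if (j <= k)%N then (-1) ^+ (k - j) * (orthopoly mu k)`_j else 0.

Lemma size_orthopoly (K : fieldType) (mu : nat -> K) (k : nat) :
  (size (orthopoly mu k) <= k.+1)%N.
Proof.
apply: leq_trans (size_scale_leq _ _) _.
rewrite (expand_det_row _ ord_max); apply: (big_ind (fun p : {poly K} => size p <= k.+1)%N).
- by rewrite size_poly0.
- by move=> p q hp hq; apply: leq_trans (size_polyD _ _) _; rewrite geq_max hp hq.
move=> j _; rewrite mxE ltnn.
have -> : cofactor (orthopoly_mx mu k) ord_max j =
    (cofactor (\matrix_(i < k.+1, j < k.+1) mu (i + j)%N) ord_max j)%:P.
  rewrite /cofactor rmorphM rmorphXn rmorphN rmorph1 -det_map_mx.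
  congr (_ * \det _); apply/matrixP=> a b.
  by rewrite !mxE lift_max ltn_ord.
rewrite mulrC mul_polyC; apply: leq_trans (size_scale_leq _ _) _.
by rewrite size_polyXn ltn_ord.
Qed.

Lemma orthopolyE (K : fieldType) (mu : nat -> K) (k : nat) :
  orthopoly mu k =
  \sum_(j < k.+1) ((-1) ^+ (k - j) * orthocoef mu k j) *: 'X^j.
Proof.
rewrite -[LHS](coefK) -(poly_def _ (fun j => (-1) ^+ (k - j) * orthocoef mu k j)).
apply/polyP=> i; rewrite !coef_poly ltnS /orthocoef.
have [ik|ki] := leqP i k; first rewrite mulrA -signr_odd -expr2 sqrr_sign mul1r.
  by case: ltnP => // h; rewrite nth_default.
by case: ltnP => // h; rewrite nth_default // (leq_trans (size_orthopoly mu k)).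
Qed.

(* Main.v *)
Require Import Defs.
From HB Require Import structures.
From mathcomp Require Import all_boot all_order all_algebra.
From mathcomp Require Import zify.

Import GRing.Theory.
Local Open Scope ring_scope.

(** Write N = n + m. Let X be the N x N matrix whose first n rows are the
    coefficients of p_m, ..., p_(N-1) and whose last m rows are the last m rows
    of the identity, and let Y be the N x N Hankel matrix with its columns
    rotated so that column m comes first. By orthogonality X Y is block lower
    triangular, with diagonal blocks an upper triangular matrix of diagonal
    H_(i+m+1) / H_(i+m) (i < n) and the shifted Hankel matrix
    (mu(i+j+n))_(i,j<m). Taking determinants gives the identity; the sign of
    the rotation, (-1)^(n m), cancels against the signs of p(k,j). *)

(** Deleting the last row removes every power of the variable, so only constants remain. *)
Lemma orthopoly_mx_cofactor (K : fieldType) (mu : nat -> K) (k : nat)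
    (j : 'I_k.+1) :
  cofactor (orthopoly_mx mu k) ord_max j =
  (cofactor (\matrix_(i < k.+1, l < k.+1) mu (i + l)%N) ord_max j)%:P.
Proof.
rewrite /cofactor rmorphM rmorphXn rmorphN rmorph1 -det_map_mx.
congr (_ * \det _); apply/matrixP=> a b.
by rewrite !mxE lift_max ltn_ord.
Qed.

Lemma coef_orthopoly (K : fieldType) (mu : nat -> K) (k : nat) (j : 'I_k.+1) :
  (orthopoly mu k)`_j = (hankel_det mu k)^-1 *
    cofactor (\matrix_(i < k.+1, l < k.+1) mu (i + l)%N) ord_max j.
Proof.
rewrite /orthopoly coefZ (expand_det_row _ ord_max) coef_sum; congr (_ * _).
rewrite (bigD1 j) //= big1 ?addr0 => [|l lj].
  by rewrite orthopoly_mx_cofactor mxE ltnn coefMC coefXn eqxx mul1r.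
rewrite orthopoly_mx_cofactor mxE ltnn coefMC coefXn.
by rewrite eq_sym (inj_eq val_inj) (negbTE lj) mul0r.
Qed.

(** Applying the moment functional to [x^l * p_k] turns the row of powers into a row of moments. The
    free bound [N] lets sums for different [k] share one length, as a matrix product requires. *)
Lemma moment_orthopoly (K : fieldType) (mu : nat -> K) (N k l : nat) :
  (k < N)%N ->
  \sum_(j < N) (orthopoly mu k)`_j * mu (j + l)%N =
  (hankel_det mu k)^-1 *
  \det (\matrix_(i < k.+1, j < k.+1) mu ((if (i < k)%N then i : nat else l) + j)%N).
Proof.
move=> kN.
rewrite (expand_det_row _ ord_max) big_distrr /=.
rewrite [LHS](bigID (fun j : 'I_N => (j < k.+1)%N)) /= [X in _ + X]big1 ?addr0.
  rewrite -(big_ord_widen N (fun j => (orthopoly mu k)`_j * mu (j + l)%N)) //.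
  apply: eq_bigr => j _; rewrite coef_orthopoly mxE ltnn addnC -mulrA.
  congr (_ * _); rewrite mulrC; congr (_ * _).
  rewrite /cofactor; congr (_ * \det _); apply/matrixP=> a b.
  by rewrite !mxE lift_max ltn_ord.
move=> j; rewrite -leqNgt => kj.
by rewrite nth_default ?mul0r // (leq_trans (size_orthopoly mu k)).
Qed.

Lemma orthopoly_orthogonal (K : fieldType) (mu : nat -> K) (N k l : nat) :
  (k < N)%N -> (l < k)%N ->
  \sum_(j < N) (orthopoly mu k)`_j * mu (j + l)%N = 0.
Proof.
move=> kN lk; rewrite moment_orthopoly //.
have lk1 : (l < k.+1)%N by apply: ltnW.
(* Rows [l] and [k] of the moment determinant coincide. *)
rewrite (@determinant_alternate _ _ _ (Ordinal lk1) ord_max) ?mulr0 //.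
  by rewrite -(inj_eq val_inj) /= ltn_eqF.
by move=> j; rewrite !mxE /= lk ltnn.
Qed.

Lemma orthopoly_norm (K : fieldType) (mu : nat -> K) (N k : nat) :
  (k < N)%N ->
  \sum_(j < N) (orthopoly mu k)`_j * mu (j + k)%N =
  hankel_det mu k.+1 / hankel_det mu k.
Proof.
move=> kN; rewrite moment_orthopoly // mulrC; congr (\det _ * _).
apply/matrixP=> i j; rewrite !mxE; case: ltnP => // ki.
by congr (mu (_ + _)%N); have := ltn_ord i; lia.
Qed.

(** Expanding along the last column on the left and the first on the right gives the same minors;
    the cofactor signs differ by [(-1) ^+ N]. *)
Lemma det_shift_col (R : comNzRingType) (N : nat) (f : nat -> nat -> R) :
  \det (\matrix_(i < N.+1, j < N.+1) f i ((j + 1) %% N.+1)%N) =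
  (-1) ^+ N * \det (\matrix_(i < N.+1, j < N.+1) f i j).
Proof.
rewrite (expand_det_col _ ord_max) (expand_det_col (\matrix_(i, j) f i j) ord0).
rewrite big_distrr /=; apply: eq_bigr => i _; rewrite !mxE /= addn1 modnn.
rewrite /cofactor addn0 exprD mulrCA (mulrC (_ ^+ i)) -!mulrA [f i _ * (_ ^+ i * _)]mulrCA.
congr (_ * (_ * (_ * \det _))); apply/matrixP=> a b; rewrite !mxE lift_max.
by rewrite lift0 addn1 modn_small // ltnS ltn_ord.
Qed.

Lemma det_rotate_cols (R : comNzRingType) (N m : nat) (f : nat -> nat -> R) :
  \det (\matrix_(i < N.+1, j < N.+1) f i ((j + m) %% N.+1)%N) =
  (-1) ^+ (N * m) * \det (\matrix_(i < N.+1, j < N.+1) f i j).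
Proof.
elim: m => [|m IHm].
  rewrite muln0 mul1r; congr (\det _); apply/matrixP=> i j; rewrite !mxE.
  by rewrite addn0 modn_small.
rewrite mulnS exprD -mulrA -IHm -(det_shift_col _ _ (fun i j => f i ((j + m) %% N.+1)%N)).
congr (\det _); apply/matrixP=> i j; rewrite !mxE modnDml.
by rewrite -addnA add1n.
Qed.

Lemma prod_hankel_ratio (K : fieldType) (mu : nat -> K) (m n : nat) :
  (forall k, hankel_det mu k != 0) ->
  \prod_(i < n) (hankel_det mu (i + m).+1 / hankel_det mu (i + m)) =
  hankel_det mu (n + m) / hankel_det mu m.
Proof.
move=> h; elim: n => [|n IHn]; first by rewrite big_ord0 divff.
by rewrite big_ord_recr IHn /= mulrC mulrA divfK.
Qed.

(** The sign of entry (i, j) splits into a row factor and a column factor, hence into two diagonal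
    matrices. *)
Lemma det_orthocoef (K : fieldType) (mu : nat -> K) (m n : nat) :
  \det (\matrix_(i < n, j < n) orthocoef mu (i + m)%N j) =
  (-1) ^+ (m * n) * \det (\matrix_(i < n, j < n) (orthopoly mu (i + m))`_j).
Proof.
have -> : \matrix_(i < n, j < n) orthocoef mu (i + m)%N j =
  diag_mx (\row_(i < n) (-1) ^+ (i + m)) *m
    (\matrix_(i < n, j < n) (orthopoly mu (i + m))`_j) *m
    diag_mx (\row_(i < n) (-1) ^+ i).
  apply/matrixP=> i j; rewrite mul_mx_diag mul_diag_mx !mxE /orthocoef.
  case: leqP => [jk|kj]; last first.
    by rewrite nth_default ?mulr0 ?mul0r // (leq_trans (size_orthopoly _ _)).
  rewrite mulrAC -exprD; congr (_ * _).
  by rewrite -signr_odd -[RHS]signr_odd oddB // !oddD.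
rewrite !det_mulmx !det_diag mulrAC -big_split /=; congr (_ * _).
(* Row sign times column sign at index [i] is [(-1) ^+ m]. *)
under eq_bigr => i _.
  rewrite !mxE -exprD addnAC exprD addnn -mul2n exprM sqrrN !expr1n mul1r.
  over.
by rewrite prodr_const card_ord exprM.
Qed.

Lemma det_orthopoly_coefs (K : fieldType) (mu : nat -> K) (m n : nat) :
  (forall k, hankel_det mu k != 0) -> (1 <= n)%N ->
  hankel_det mu m * \det (\matrix_(i < n, j < n) (orthopoly mu (i + m))`_j) =
  (-1) ^+ (m * n) * \det (\matrix_(i < m, j < m) mu (i + j + n)%N).
Proof.
case: n => // n hH _.
set Q := \matrix_(i, j) _`_j; set G := \matrix_(i, j) mu _.
pose R := \matrix_(i < n.+1, j < m) (orthopoly mu (i + m))`_(n.+1 + j).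
pose X := block_mx Q R 0 1%:M.
pose Y := \matrix_(i < n.+1 + m, j < n.+1 + m) mu (i + (j + m) %% (n.+1 + m))%N.
pose U := \matrix_(i < n.+1, j < n.+1)
  \sum_(k < n.+1 + m) (orthopoly mu (i + m))`_k * mu (k + (j + m))%N.
have XYu (i : 'I_n.+1) j : (X *m Y) (lshift m i) j =
    \sum_(k < n.+1 + m) (orthopoly mu (i + m))`_k * mu (k + (j + m) %% (n.+1 + m))%N.
  rewrite mxE; apply: eq_bigr => k _; rewrite [Y _ _]mxE; congr (_ * _).
  rewrite -[k]splitK; case: split => k' /=.
    by rewrite block_mxEul mxE.
  by rewrite block_mxEur mxE.
(* The lower rows of [X] are identity rows, so they copy those of [Y]. *)
have XYd : dsubmx (X *m Y) = dsubmx Y.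
  rewrite -[Y in X *m Y]vsubmxK mul_block_col mul0mx add0r mul1mx.
  by rewrite col_mxKd.
have modl (j : 'I_n.+1) : ((j + m) %% (n.+1 + m))%N = (j + m)%N.
  by rewrite modn_small // ltn_add2r.
have modr (j : 'I_m) : ((n.+1 + j + m) %% (n.+1 + m))%N = j.
  by rewrite addnAC modnDl modn_small // ltn_addl.
have lti (i : 'I_n.+1) : (i + m < n.+1 + m)%N by rewrite ltn_add2r.
have XYE : X *m Y = block_mx U 0 (dlsubmx Y) G.
  rewrite -[LHS]submxK; congr block_mx.
  - by apply/matrixP=> i j; rewrite [LHS]mxE [LHS]mxE XYu mxE /= modl.
  - apply/matrixP=> i j; rewrite [LHS]mxE [LHS]mxE XYu [RHS]mxE /= modr.
    (* The rotated columns are moments of order [j < m], below every degree [i + m]. *)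
    by apply: orthopoly_orthogonal => //; rewrite ltn_addl.
  - by rewrite /dlsubmx XYd.
  rewrite /drsubmx XYd; apply/matrixP=> i j; rewrite !mxE /= modr.
  by congr mu; lia.
have detU : \det U = hankel_det mu (n.+1 + m) / hankel_det mu m.
  (* Transposing makes [U] lower triangular, as [det_trig] expects; the diagonal product
     telescopes. *)
  rewrite -(prod_hankel_ratio _ _ _ _ hH) -det_tr det_trig.
    by apply: eq_bigr => i _; rewrite !mxE orthopoly_norm.
  apply/is_trig_mxP=> i j ij; rewrite !mxE.
  by apply: orthopoly_orthogonal; rewrite ?ltn_add2r.
have detY : \det Y = (-1) ^+ (m * n.+1) * hankel_det mu (n.+1 + m).
  rewrite /Y (det_rotate_cols _ (n + m) m (fun i j => mu (i + j)%N)); congr (_ * _).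
  (* The exponents [(n + m) * m] and [m * n.+1] have equal parity, since [m * m] and [m] do. *)
  rewrite -signr_odd -[RHS]signr_odd; congr (_ ^+ nat_of_bool _).
  by rewrite !oddM oddD /=; case: (odd n); case: (odd m).
have := congr1 determinant XYE.
rewrite det_mulmx det_lblock det_ublock det1 mulr1 detU detY => E.
(* Both sides of [E] carry the nonzero Hankel determinant of order [n.+1 + m]; it is cancelled
   here. *)
apply: (mulfI (hH (n.+1 + m)%N)).
set s := (-1) ^+ _ in E *; set H := hankel_det mu (n.+1 + m) in E *.
have -> : H * (s * \det G) =
    s * (hankel_det mu m * (H / hankel_det mu m * \det G)).
  by rewrite (mulrA (hankel_det mu m)) [_ * (H / _)]mulrC divfK // mulrCA.
rewrite -E (mulrCA (\det Q)) (mulrCA (hankel_det mu m)) /s signrMK.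
by rewrite mulrA mulrC.
Qed.

Theorem mainTheorem1 (K : fieldType) (mu : nat -> K)
    (mu0 : mu 0%N = 1) (hankel_neq0 : forall k : nat, hankel_det mu k != 0)
    (m n : nat) (n_ge1 : (1 <= n)%N) :
  \det (\matrix_(i < m, j < m) mu (i + j)%N)
    * \det (\matrix_(i < n, j < n) orthocoef mu (i + m)%N j)
  = \det (\matrix_(i < m, j < m) mu (i + j + n)%N).
Proof.
rewrite det_orthocoef mulrCA -/(hankel_det mu m) det_orthopoly_coefs //.
by rewrite signrMK.
Qed.
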